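(* Let $R=k[x_0,\ldots,x_n]$ be a polynomial ring over a field $k$ and let $\mathcal F$ be a set of forms in $R$. If $\mathcal F$ allows a unique monomial support, then for every monomial $M$ in $\mathcal F$ there exists a unique normal form of $M$ with respect to $\mathcal F$. In particular, in this case $\lambda_{\mathcal F}(M)$ is the length of the normal form of $M$.
   Context: A form is a homogeneous polynomial. A monomial in $\mathcal F$ is an element of $R$ that can be written as a product $F_{i_1}\cdots F_{i_r}$ (possibly with repetition) of elements of $\mathcal F$; it is squarefree if it can be written as such a product with pairwise distinct factors. The set $\mathcal F$ allows a unique monomial support if for every monomial $M$ in $\mathcal F$ there is only one way, up to reordering, to write $M$ as a product of elements of $\mathcal F$; in this case the support $\mathrm{supp}(M)\subseteq\mathcal F$ is the (well-defined) set of elements of $\mathcal F$ occurring in this product. If $\mathcal F$ allows a unique monomial support, a normal form of $M$ with respect to $\mathcal F$ is an expression $M=M^{(1)}\cdots M^{(t)}$ where all $M^{(j)}$ are squarefree monomials in $\mathcal F$ and $\emptyset\neq \mathrm{supp}(M^{(i+1)})\subseteq \mathrm{supp}(M^{(i)})$ for all $i=1,\ldots,t-1$; the number $t$ is its length. For an arbitrary set of forms $\mathcal F$, $\lambda_{\mathcal F}(M)$ denotes the minimum of all $t$ for which there are subsets $\emptyset\subseteq S_1\subseteq S_2\subseteq\cdots\subseteq S_t\subseteq\mathcal F$ with $M=\prod_{i=1}^t\prod_{F\in S_i}F$. *)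

(* Defs.v *)
From HB Require Import structures.
From mathcomp Require Import all_boot all_order all_algebra.
From mathcomp Require Import finmap mpoly boolp classical_sets.

Set Implicit Arguments.
Unset Strict Implicit.
Unset Printing Implicit Defensive.

Import GRing.Theory.

Local Open Scope classical_set_scope.
Local Open Scope ring_scope.

Section Monomials.

Context {k : fieldType} {n : nat}.
Implicit Types (F : set {mpoly k[n]}) (M f : {mpoly k[n]}).

(* The zero polynomial is a form (of every degree). *)
Definition is_form f : Prop := exists d, f \is d.-homog.

(* [s] lists, with repetition, the factors of a product of elements of [F]
   equal to [M]; the empty product (M = 1) is allowed. *)
Definition factorization F M (s : seq {mpoly k[n]}) : Prop :=
  [set` s] `<=` F /\ M = \prod_(f <- s) f.

Definition monomial_in F M : Prop := exists s, factorization F M s.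

Definition squarefree_monomial_in F M : Prop :=
  exists2 s, factorization F M s & uniq s.

Definition unique_monomial_support F : Prop :=
  forall M, monomial_in F M ->
  forall s1 s2, factorization F M s1 -> factorization F M s2 -> perm_eq s1 s2.

(* Only meaningful when [F] allows a unique monomial support: then all
   factorizations of [M] have the same elements. *)
Definition supp F M : set {mpoly k[n]} :=
  [set f | exists2 s, factorization F M s & f \in s].

(* [Ms] is the list M^(1), ..., M^(t), with t >= 1, so that [size Ms] is the
   length.  Only M^(2), ..., M^(t) are required to have nonempty support, so
   M = 1 has the normal form [:: 1], of length 1. *)
Definition normal_form F M (Ms : seq {mpoly k[n]}) : Prop :=
  [/\ (0 < size Ms)%N,
      M = \prod_(N <- Ms) N,
      forall N, N \in Ms -> squarefree_monomial_in F N
    & forall i, (i.+1 < size Ms)%N ->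
        supp F Ms`_i.+1 !=set0 /\ supp F Ms`_i.+1 `<=` supp F Ms`_i].

(* The sets S_i are finite, since the product of their elements is taken; they
   may be empty.  As for normal forms, t >= 1. *)
Definition has_chain F M (t : nat) : Prop :=
  (0 < t)%N /\
  exists S : 'I_t -> {fset {mpoly k[n]}},
    [/\ forall i j : 'I_t, (i <= j)%N -> (S i `<=` S j)%fset,
        forall i, [set` S i] `<=` F
      & M = \prod_(i < t) \prod_(f <- S i) f].

(* The value 0 is a default for the case where there is no chain, i.e. where
   [M] is not a monomial in [F]. *)
Definition lambda F M : nat :=
  if pselect (exists t, `[< has_chain F M t >]) is left ex_t
  then ex_minn ex_t else 0%N.

Lemma lambdaP F M t : has_chain F M t ->
  has_chain F M (lambda F M) /\
  forall u, has_chain F M u -> (lambda F M <= u)%N.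
Proof.
move=> Ht; rewrite /lambda; case: pselect => [ex_t|[]]; last first.
  by exists t; apply/asboolP.
case: ex_minnP => m /asboolP Hm min_m; split=> // u Hu.
by apply: min_m; apply/asboolP.
Qed.

End Monomials.

(* Main.v *)
Require Import Defs.
From HB Require Import structures.
From mathcomp Require Import all_boot all_order all_algebra.
From mathcomp Require Import finmap mpoly boolp classical_sets.

Set Implicit Arguments.
Unset Strict Implicit.
Unset Printing Implicit Defensive.

(** When [F] allows a unique monomial support, a monomial [M] in [F] is the same
    thing as a finite multiset [s] of elements of [F], and a squarefree monomial
    is the same thing as a finite subset of [F].  The theorem is then the
    statement that a multiset is a sum of a decreasing sequence of sets in
    exactly one way: if [s] is the sum of the sets N_0, N_1, ... with
    N_0 containing N_1 containing N_2 and so on, the indices [i] with [f] in N_i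
    form an initial segment of the natural numbers, whose length is the
    multiplicity of [f] in [s].  Hence N_i must be the set of elements of
    multiplicity greater than [i], which is called [layer s i] below
    ([mem_nth_nested]); and these sets do add up to [s]
    ([perm_flatten_layers]).  The number of terms is the largest multiplicity,
    since all terms but the first are nonempty; it is at least 1 because the
    monomial 1 has the normal form consisting of 1 alone, hence the definition
    of [height].

    For [lambda], the layers in reverse order are a chain of length [height s];
    conversely a chain of length [u] writes [s] as a sum of [u] sets, each of
    which contains a given element at most once, so that no multiplicity exceeds
    [u] ([height_le_size]). *)

(** * Multisets as sums of decreasing sequences of sets *)

Section Layers.

Variable T : eqType.
Implicit Types (s N : seq T) (ss : seq (seq T)).

Definition layer s i : seq T := [seq f <- undup s | i < count_mem f s].

(** The maximum with 1 makes the empty multiset have one, empty, layer, as the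
    monomial 1 has a normal form of length 1. *)
Definition height s : nat := maxn 1 (\max_(f <- s) count_mem f s).

Definition layers s : seq (seq T) := [seq layer s i | i <- iota 0 (height s)].

Definition contains N1 N2 : bool := all (mem N1) N2.

Lemma containsP N1 N2 : reflect {subset N2 <= N1} (contains N1 N2).
Proof. exact: allP. Qed.

Lemma contains_trans : transitive contains.
Proof.
move=> N2 N1 N3 /containsP s21 /containsP s32.
by apply/containsP => f /s32/s21.
Qed.

Lemma mem_layer s i f : (f \in layer s i) = (i < count_mem f s).
Proof.
rewrite mem_filter mem_undup andb_idr // => lt_i.
by rewrite -has_pred1 has_count (leq_ltn_trans _ lt_i).
Qed.

Lemma layer_uniq s i : uniq (layer s i).
Proof. exact/filter_uniq/undup_uniq. Qed.

Lemma layer_sub s i : {subset layer s i <= s}.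
Proof. by move=> f; rewrite mem_filter mem_undup => /andP[]. Qed.

Lemma layerS s i j : i <= j -> {subset layer s j <= layer s i}.
Proof. by move=> le_ij f; rewrite !mem_layer; exact: leq_ltn_trans. Qed.

Lemma height_gt0 s : 0 < height s.
Proof. by rewrite leq_max. Qed.

Lemma count_le_height s f : count_mem f s <= height s.
Proof.
have [f_s|/count_memPn-> //] := boolP (f \in s).
rewrite leq_max; apply/orP; right.
exact: (leq_bigmax_seq (F := fun f => count_mem f s) f).
Qed.

Lemma height_le s n :
  0 < n -> (forall f, count_mem f s <= n) -> height s <= n.
Proof. by move=> n_gt0 le_n; rewrite geq_max n_gt0; apply/bigmax_leqP_seq. Qed.

Lemma layer_height_neq0 s i : 0 < i < height s -> exists f, f \in layer s i.
Proof.
case/andP=> i_gt0; rewrite ltnNge => /negP lt_i.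
apply: contrapT => /forallNP no_f; apply: lt_i; apply: height_le => // f.
by rewrite leqNgt -mem_layer; apply/negP.
Qed.

Lemma size_layers s : size (layers s) = height s.
Proof. by rewrite size_map size_iota. Qed.

Lemma nth_layers s i : i < height s -> nth [::] (layers s) i = layer s i.
Proof. by move=> lt_i; rewrite (nth_map 0) ?size_iota // nth_iota. Qed.

Lemma count_flatten_uniq f ss :
  all uniq ss -> count_mem f (flatten ss) = count [pred N : seq T | f \in N] ss.
Proof.
elim: ss => //= N ss IHss /andP[uN uss].
by rewrite count_cat IHss // count_uniq_mem.
Qed.

(** The element [f] occurs in [min (count_mem f s) (height s)] of the layers,
    and the minimum is its multiplicity. *)
Lemma perm_flatten_layers s : perm_eq (flatten (layers s)) s.
Proof.
apply/allP => f _ /=; apply/eqP; rewrite count_flatten_uniq; last first.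
  by apply/allP => _ /mapP[i _ ->]; exact: layer_uniq.
rewrite count_map (eq_count (a2 := fun i => i < count_mem f s)); last first.
  by move=> i /=; rewrite mem_layer.
by rewrite -size_filter (filter_iota_ltn 0 (count_le_height s f)) size_iota.
Qed.

(** The terms containing [f] come first, and there are as many of them as the
    multiplicity of [f] in the sum. *)
Lemma mem_nth_nested ss i f : all uniq ss -> sorted contains ss ->
  (f \in nth [::] ss i) = (i < count_mem f (flatten ss)).
Proof.
elim: ss i => [|N ss IHss] i /=; first by rewrite nth_nil.
case/andP=> uN uss nested_ss.
have {}IHss j := IHss j uss (path_sorted nested_ss).
have sub_N : {subset flatten ss <= N}.
  move=> g /flattenP[N' N'_ss g_N'].
  have /allP/(_ _ N'_ss)/containsP := order_path_min contains_trans nested_ss.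
  exact.
rewrite count_cat count_uniq_mem //.
have [f_N|fN] := boolP (f \in N).
  by case: i => [|i] /=; rewrite ?f_N // IHss add1n.
have c0 : count_mem f (flatten ss) = 0.
  by apply/count_memPn; apply: contra fN => /sub_N.
by rewrite c0; case: i => [|i] /=; [exact: negbTE | rewrite IHss c0].
Qed.

(** The last term is nonempty or is the only one, so the number of terms cannot
    exceed [height s]; an element of multiplicity greater than [size ss] would
    belong to a term beyond the last one. *)
Lemma size_nested s ss : all uniq ss -> sorted contains ss ->
    perm_eq (flatten ss) s -> 0 < size ss ->
    (forall i, 0 < i < size ss -> exists f, f \in nth [::] ss i) ->
  size ss = height s.
Proof.
move=> uss nested_ss /permP eq_s ss_gt0 ss_neq0.
have mem_ss i f : (f \in nth [::] ss i) = (i < count_mem f s).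
  by rewrite mem_nth_nested // eq_s.
apply/eqP; rewrite eqn_leq; apply/andP; split; last first.
  (* The default value [::] stands for the terms beyond the last one. *)
  by apply: height_le => // f; rewrite leqNgt -mem_ss nth_default.
have [last0|last_gt0] := posnP (size ss).-1.
  by rewrite -(prednK ss_gt0) last0 height_gt0.
have [|f] := ss_neq0 (size ss).-1; first by rewrite last_gt0 ltn_predL.
by rewrite mem_ss prednK // => /leq_trans; apply; exact: count_le_height.
Qed.

Lemma height_le_size s ss : all uniq ss -> perm_eq (flatten ss) s ->
  0 < size ss -> height s <= size ss.
Proof.
move=> uss /permP eq_s ss_gt0; apply: height_le => // f.
by rewrite -eq_s count_flatten_uniq // count_size.
Qed.

End Layers.

(** * Monomials and their factorizations *)

Section NormalForms.

Import GRing.Theory.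
Local Open Scope ring_scope.

Variables (k : fieldType) (n : nat) (F : set {mpoly k[n]}).
Hypothesis F_unique : unique_monomial_support F.
Implicit Types (M N : {mpoly k[n]}) (s : seq {mpoly k[n]}).

Definition monomial s : {mpoly k[n]} := \prod_(f <- s) f.

Lemma factorization_monomial s :
  {subset s <= F} -> factorization F (monomial s) s.
Proof. by move=> sF; split=> // f /= /sF; rewrite inE. Qed.

Lemma factorization_sub M s : factorization F M s -> {subset s <= F}.
Proof. by case=> sF _ f f_s; rewrite inE; exact: sF. Qed.

Lemma monomial_flatten (ss : seq (seq {mpoly k[n]})) :
  monomial (flatten ss) = \prod_(N <- map monomial ss) N.
Proof. by rewrite /monomial big_flatten big_map. Qed.

Lemma perm_factorization M s1 s2 :
  factorization F M s1 -> factorization F M s2 -> perm_eq s1 s2.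
Proof. by move=> M1; apply: F_unique => //; exists s1. Qed.

(** This is what lets the inclusions between supports, in the definition of a
    normal form, be read on any chosen lists of factors. *)
Lemma mem_supp M s f : factorization F M s -> supp F M f <-> f \in s.
Proof.
move=> M_s; split=> [[s' M_s' f_s']|f_s]; last by exists s.
by rewrite -(perm_mem (perm_factorization M_s' M_s)).
Qed.

(** The passage from polynomials to finite sets of elements of [F], represented
    by duplicate-free lists. *)
Lemma squarefree_monomials_lift Ms :
    (forall N, N \in Ms -> squarefree_monomial_in F N) ->
  exists ss, [/\ Ms = map monomial ss, all uniq ss
               & forall s, s \in ss -> {subset s <= F}].
Proof.
elim: Ms => [|N Ms IHMs] sqf_Ms; first by exists [::].
have [|ss [-> uss ssF]] := IHMs.
  by move=> N' N'_Ms; apply: sqf_Ms; rewrite inE N'_Ms orbT.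
have [s N_s us] := sqf_Ms N (mem_head N Ms); exists (s :: ss).
split=> /=; [by case: N_s => _ -> | by rewrite us |].
by move=> s'; rewrite inE => /predU1P[->|/ssF//]; exact: factorization_sub N_s.
Qed.

Lemma nth_monomial (ss : seq (seq {mpoly k[n]})) i : (i < size ss)%N ->
  (map monomial ss)`_i = monomial (nth [::] ss i).
Proof. by move=> lt_i; rewrite (nth_map [::]). Qed.

Lemma layers_normal_form M s : factorization F M s ->
  normal_form F M (map monomial (layers s)).
Proof.
move=> M_s; have sF := factorization_sub M_s.
have layerF i : factorization F (monomial (layer s i)) (layer s i).
  by apply: factorization_monomial => f /layer_sub/sF.
split.
- by rewrite size_map size_layers height_gt0.
- rewrite -monomial_flatten /monomial (perm_big _ (perm_flatten_layers s)) /=.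
  by case: M_s.
- move=> _ /mapP[_ /mapP[i _ ->] ->].
  by exists (layer s i); [exact: layerF | exact: layer_uniq].
move=> i; rewrite size_map size_layers => lt_i.
rewrite !nth_monomial ?size_layers ?(ltnW lt_i) //.
rewrite !nth_layers ?(ltnW lt_i) //; split.
  have [|f f_i] := @layer_height_neq0 _ s i.+1; first by rewrite lt_i.
  by exists f; apply/(mem_supp f (layerF _)).
move=> f /(mem_supp f (layerF _)) f_i.
by apply/(mem_supp f (layerF _)); exact: layerS f_i.
Qed.

(** A normal form lifts to a decreasing sequence of sets with sum [s], and
    such a sequence consists of the layers of [s]. *)
Lemma normal_form_layers M s Ms : factorization F M s ->
  normal_form F M Ms -> Ms = map monomial (layers s).
Proof.
move=> M_s [Ms_gt0 MMs sqf_Ms supp_Ms].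
have [ss [eMs uss ssF]] := squarefree_monomials_lift sqf_Ms.
rewrite {}eMs in Ms_gt0 MMs supp_Ms *; move: Ms_gt0 supp_Ms.
rewrite size_map => ss_gt0 supp_ss.
have nthF i : (i < size ss)%N ->
    factorization F (monomial (nth [::] ss i)) (nth [::] ss i).
  by move=> lt_i; apply/factorization_monomial/ssF/mem_nth.
have eq_s : perm_eq (flatten ss) s.
  apply: perm_factorization M_s; rewrite MMs -monomial_flatten.
  by apply: factorization_monomial => f /flattenP[s' /ssF]; exact.
have nested_ss : sorted (@contains _) ss.
  apply/(sortedP [::]) => i lt_i; apply/containsP => f f_i.
  have [_ sub_i] := supp_ss i lt_i; apply/(mem_supp f (nthF i (ltnW lt_i))).
  rewrite -nth_monomial ?(ltnW lt_i) //; apply: sub_i; rewrite nth_monomial //.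
  exact/(mem_supp f (nthF _ lt_i)).
have sz_ss : size ss = height s.
  apply: size_nested => // -[|i] //= lt_i.
  have [[f]] := supp_ss i lt_i; rewrite nth_monomial //.
  by move=> /(mem_supp f (nthF _ lt_i)) f_i _; exists f.
apply: (@eq_from_nth _ 0) => [|i]; first by rewrite !size_map size_iota.
rewrite size_map => lt_i; rewrite !nth_monomial ?size_layers -?sz_ss //.
rewrite nth_layers -?sz_ss //; apply: perm_big; apply: uniq_perm.
- by apply: (allP uss); exact: mem_nth.
- exact: layer_uniq.
by move=> f; rewrite mem_layer mem_nth_nested // (permP eq_s).
Qed.

(** * Chains of subsets *)

Lemma layers_chain M s : factorization F M s -> has_chain F M (height s).
Proof.
move=> M_s; split; first exact: height_gt0.
exists (fun i => [fset f in layer s (rev_ord i)]%fset); split.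
- move=> i j le_ij; apply/fsubsetP => f; rewrite !inE; apply: layerS => /=.
  exact: leq_sub2l.
- move=> i f /=; rewrite inE => /layer_sub f_s.
  by case: M_s => sF _; exact: sF.
have [_ ->] := M_s; rewrite -(perm_big _ (perm_flatten_layers s)) /=.
(* The layers decrease while the sets of a chain increase. *)
rewrite big_flatten big_map -{1}[height s]subn0 big_mkord.
rewrite (reindex_inj rev_ord_inj) /=; apply: eq_bigr => i _.
apply: perm_big; apply: uniq_perm; [exact: layer_uniq | exact: fset_uniq |].
by move=> f; rewrite inE.
Qed.

(** By unique factorization, the sets of the chain have sum [s]. *)
Lemma height_le_chain M s u :
  factorization F M s -> has_chain F M u -> (height s <= u)%N.
Proof.
move=> M_s [u_gt0 [S [_ SF MS]]].
pose ss := [seq (S i : seq _) | i <- enum 'I_u].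
have sz_ss : size ss = u by rewrite size_map size_enum_ord.
rewrite -sz_ss; apply: height_le_size; rewrite ?sz_ss //.
  by apply/allP => _ /mapP[i _ ->]; exact: fset_uniq.
apply: perm_factorization M_s; split.
  by move=> f /flattenP[_ /mapP[i _ ->] f_i]; exact: SF f_i.
by rewrite MS big_flatten big_map big_enum.
Qed.

Lemma lambda_height M s : factorization F M s -> lambda F M = height s.
Proof.
move=> M_s; have [chain_lambda min_lambda] := lambdaP (layers_chain M_s).
apply/eqP; rewrite eqn_leq (height_le_chain M_s chain_lambda) andbT.
exact/min_lambda/layers_chain.
Qed.

End NormalForms.

Theorem theorem3p12 (k : fieldType) (n : nat) (F : set {mpoly k[n.+1]})
    (F_forms : forall f, F f -> is_form f)
    (F_unique : unique_monomial_support F)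
    (M : {mpoly k[n.+1]}) (F_M : monomial_in F M) :
  (exists! Ms : seq {mpoly k[n.+1]}, normal_form F M Ms) /\
  (forall Ms : seq {mpoly k[n.+1]}, normal_form F M Ms ->
     lambda F M = size Ms).
Proof.
have [s M_s] := F_M; split=> [|Ms nf_Ms].
  exists (map (@monomial k n.+1) (layers s)); split=> [|Ms nf_Ms].
    exact: layers_normal_form.
  by rewrite (normal_form_layers F_unique M_s nf_Ms).
rewrite (normal_form_layers F_unique M_s nf_Ms) size_map size_layers.
exact: lambda_height.
Qed.
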